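(* Let $n\ge 2$, $m\ge 1$, let $F=(f_1,\dots,f_m):\mathbb{C}^n\to\mathbb{C}^m$ be a polynomial mapping and let $S:=\{z\in\mathbb{C}^n : f_1(z)\cdot\ldots\cdot f_m(z)=0\}$. If $S\neq\emptyset$, then $$\mathcal{L}_\infty(F)=\mathcal{L}_\infty(F|S),$$ where $\mathcal{L}_\infty$ denotes the Łojasiewicz exponent at infinity.
   Context: $|\cdot|$ denotes the polycylindric (maximum) norm, $|z|=\max_i|z_i|$, on $\mathbb{C}^k$. For a polynomial mapping $F:\mathbb{C}^n\to\mathbb{C}^m$ ($n\ge 2$) and an unbounded algebraic set $S\subset\mathbb{C}^n$ put $$N(F|S):=\{\nu\in\mathbb{R} : \exists A>0,\ \exists B>0,\ \forall z\in S,\ (|z|>B\Rightarrow A|z|^\nu\le|F(z)|)\}.$$ The Łojasiewicz exponent at infinity of $F|S$ is $\mathcal{L}_\infty(F|S):=\sup N(F|S)$, with values in the extended reals and the convention $\sup\emptyset=-\infty$. For $S=\mathbb{C}^n$ one writes $N(F):=N(F|\mathbb{C}^n)$ and $\mathcal{L}_\infty(F):=\sup N(F)$. (The set $S$ in the theorem, being nonempty and either a hypersurface in $\mathbb{C}^n$ with $n\ge2$ or all of $\mathbb{C}^n$, is an unbounded algebraic set.) *)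

(* Defs.v *)
From mathcomp Require Import all_boot all_order all_algebra.
From mathcomp Require Import complex.
From mathcomp Require mpoly.
From mathcomp Require Import all_classical all_reals all_analysis.

Set Implicit Arguments.
Unset Strict Implicit.
Unset Printing Implicit Defensive.

Import Order.TTheory GRing.Theory Num.Theory.

Local Open Scope classical_set_scope.
Local Open Scope ring_scope.

(* The library norm [`|x|] on [R[i]] takes its values in [R[i]]; [normc] is
   the modulus as an element of [R].  Moduli are nonnegative, so starting the
   maximum at 0 is harmless. *)
Definition polycyl_norm (R : realType) (k : nat) (z : 'I_k -> R[i]) : R :=
  \big[Num.max/0]_(i < k) Normc.normc (z i).

(* [mpoly] is only required, not imported, because its notations are
   incompatible with those of the analysis library. *)
Definition polymap (R : realType) (n m : nat) : Type :=
  'I_m -> mpoly.mpoly n R[i].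

Definition polymap_eval (R : realType) (n m : nat) (F : polymap R n m)
    (z : 'I_n -> R[i]) : 'I_m -> R[i] :=
  fun j => mpoly.meval z (F j).

Definition loj_set (R : realType) (n m : nat) (F : polymap R n m)
    (S : set ('I_n -> R[i])) : set R :=
  [set nu | exists A B : R, [/\ 0 < A, 0 < B &
     forall z, S z -> B < polycyl_norm z ->
       A * polycyl_norm z `^ nu <= polycyl_norm (polymap_eval F z)]].

(* [ereal_sup set0] is [-oo]. *)
Definition loj_exponent (R : realType) (n m : nat) (F : polymap R n m)
    (S : set ('I_n -> R[i])) : \bar R :=
  ereal_sup (EFin @` loj_set F S).

Definition prod_zero_set (R : realType) (n m : nat) (F : polymap R n m) :
    set ('I_n -> R[i]) :=
  [set z | \prod_(j < m) polymap_eval F z j = 0].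

(* Main.v *)
(** If some f_j vanishes identically then S is the whole space. Otherwise fix
    a direction v at which the leading form of every f_j is nonzero. Given z,
    let t be the zero of f_1...f_m on the line z + C v nearest to z. No factor
    has a zero closer to z, so factoring each f_j(z + s v) over its roots gives
    |f_j(z + t v)| <= 2^(deg f_j) |f_j(z)| and |t|^(deg f_j) <= c |f_j(z)|.
    If |t v| <= |z|/2, the point z + t v of S has norm comparable to |z|, and a
    lower bound for |F| on S transfers to z. Otherwise |F(z)| >= c |z|^D with
    D the largest degree, and exponents admissible on S never exceed D because
    S is unbounded. Hence N(F) = N(F|S), without curve selection. *)

Require Import Defs.
From mathcomp Require Import all_boot all_order all_algebra.
From mathcomp Require Import complex.
From mathcomp Require mpoly.
From mathcomp Require Import all_classical all_reals all_analysis.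
From mathcomp Require Import ring lra.
Import Order.TTheory GRing.Theory Num.Theory.
Import -(notations) mpoly.
Local Open Scope classical_set_scope.
Local Open Scope ring_scope.

Set Implicit Arguments.
Unset Strict Implicit.
Unset Printing Implicit Defensive.

(** * Univariate polynomials at a point no farther from 0 than any root *)

Lemma prod_norm_sub_le (C : numFieldType) (t : C) (rs : seq C) :
  (forall x, x \in rs -> `|t| <= `|x|) ->
  `|\prod_(x <- rs) (t - x)| <= 2 ^+ size rs * `|\prod_(x <- rs) (0 - x)| /\
  `|t| ^+ size rs <= `|\prod_(x <- rs) (0 - x)|.
Proof.
elim: rs => [|x rs IH] h; first by rewrite !big_nil !expr0 mul1r normr1.
have [|IH1 IH2] := IH; first by move=> y hy; apply: h; rewrite inE hy orbT.
have htx : `|t| <= `|x| by apply: h; rewrite inE eqxx.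
rewrite !big_cons /= !exprS !normrM sub0r normrN; split; last exact: ler_pM.
rewrite mulrACA ler_pM // (le_trans (ler_normB _ _)) //.
by rewrite mulrDl mul1r lerD2r.
Qed.

(** Factor [p] over its roots. Each root [x] satisfies [|t - x| <= |t| + |x| <= 2 |x|] and
    [|t| <= |x|]; multiplying over the roots gives the two bounds, whose exponent is the degree of
    [p]. *)
Lemma norm_horner_near_root (C : numClosedFieldType) (p : {poly C}) (t : C) :
  (forall x, root p x -> `|t| <= `|x|) ->
  `|p.[t]| <= 2 ^+ (size p).-1 * `|p.[0]| /\
  `|lead_coef p| * `|t| ^+ (size p).-1 <= `|p.[0]|.
Proof.
have [->|p0] := eqVneq p 0.
  by rewrite !horner0 lead_coef0 !normr0 mulr0 mul0r.
have [rs defp] := closed_field_poly_normal p => h.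
have c0 : lead_coef p != 0 by rewrite lead_coef_eq0.
have sp : (size p).-1 = size rs.
  by rewrite defp size_scale // size_prod_XsubC.
have [x hx|h1 h2] := prod_norm_sub_le (t := t) (rs := rs).
  by apply: h; rewrite defp rootZ // root_prod_XsubC.
have ev y : p.[y] = lead_coef p * \prod_(x <- rs) (y - x).
  rewrite {1}defp hornerZ horner_prod; congr (_ * _).
  by apply: eq_bigr => x _; rewrite !hornerE.
by rewrite sp !ev !normrM; split; [rewrite mulrCA|]; apply: ler_wpM2l.
Qed.

Lemma seq_norm_argmin (C : numDomainType) (rs : seq C) : rs != [::] ->
  exists2 t, t \in rs & forall x, x \in rs -> `|t| <= `|x|.
Proof.
elim: rs => // x [|y rs] IH _.
  by exists x; rewrite ?inE // => y; rewrite inE => /eqP ->.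
have [//|t ht h] := IH.
have [le|lt] := real_leP (normr_real x) (normr_real t).
  exists x; first by rewrite inE eqxx.
  by move=> z; rewrite inE => /orP[/eqP -> //|/h]; apply: le_trans.
exists t; first by rewrite inE ht orbT.
by move=> z; rewrite inE => /orP[/eqP ->|/h //]; apply: ltW.
Qed.

(** * A direction at which no leading form vanishes *)

Lemma base_digits_inj (K n : nat) (a b : 'I_n -> nat) :
  (forall i, a i < K)%N -> (forall i, b i < K)%N ->
  (\sum_i a i * K ^ i = \sum_i b i * K ^ i)%N -> a =1 b.
Proof.
elim: n a b => [|n IH] a b ha hb.
  by move=> _ i; have := ltn_ord i.
have K0 : (0 < K)%N by apply: leq_ltn_trans (ha ord0).
have E (c : 'I_n.+1 -> nat) : (\sum_i c i * K ^ i =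
    (\sum_(i < n) c (lift ord0 i) * K ^ i) * K + c ord0)%N.
  rewrite big_ord_recl expn0 muln1 addnC big_distrl; congr (_ + _)%N.
  by apply: eq_bigr => i _; rewrite lift0 expnSr mulnA.
rewrite !E => e.
have e0 : a ord0 = b ord0.
  by move/(congr1 (modn^~ K)): e; rewrite !modnMDl !modn_small.
have es := congr1 (divn^~ K) e.
rewrite !divnMDl // !divn_small // !addn0 in es.
move=> i; case: (unliftP ord0 i) => [j ->|-> //].
by apply: (IH (a \o lift ord0) (b \o lift ord0)) => //= k.
Qed.

(** The leading form of [f] evaluated at [v]; [msize f] is one more than the degree when [f] is
    nonzero. *)
Definition topform (R : nzRingType) (n : nat) (f : mpoly n R) (v : 'I_n -> R) :=
  \sum_(m <- msupp f | mdeg m == (msize f).-1)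
    mcoeff m f * \prod_i v i ^+ m i.

(* Kronecker substitution [v i = x ^ (K ^ i)] separates the monomials. *)
Lemma exists_topform_neq0 (C : closedFieldType) (n m : nat)
    (F : 'I_m -> mpoly n C) : (forall j, F j != 0) ->
  exists v : 'I_n -> C, (forall i, v i != 0) /\ forall j, topform (F j) v != 0.
Proof.
move=> F0.
pose K := (\max_j msize (F j)).+1.
pose e (a : multinom n) := (\sum_i a i * K ^ i)%N.
pose Q j : {poly C} := \sum_(a <- msupp (F j) | mdeg a == (msize (F j)).-1)
    mcoeff a (F j) *: 'X^(e a).
(* Exponents below [K] are base [K] digits, so [e] is injective on the monomials of each [F j]. *)
have ltK j a i : a \in msupp (F j) -> (a i < K)%N.
  move=> /msize_mdeg_lt h; rewrite ltnS.
  apply: leq_trans (leq_bigmax j); apply: leq_trans (ltnW h).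
  by rewrite mdegE (bigD1 i) //= leq_addr.
have Q0 j : Q j != 0.
  have hl := mlead_supp (F0 j); set l := mlead (F j) in hl.
  have dl : mdeg l == (msize (F j)).-1 by rewrite -(mlead_deg (F0 j)).
  (* By injectivity of [e], only the leading monomial [l] contributes to the coefficient of index
     [e l]. *)
  apply/eqP => /(congr1 (fun q : {poly C} => q`_(e l))).
  rewrite coef0 coef_sum (big_rem l) //= dl coefZ coefXn eqxx mulr1 big_seq_cond.
  rewrite big1 ?addr0; first by apply/eqP; rewrite -mcoeff_msupp.
  move=> a; rewrite (mem_rem_uniq _ (msupp_uniq _)) inE => /andP[/andP[al ha] _].
  rewrite coefZ coefXn; case: eqP => [E|_]; last by rewrite mulr0.
  case/eqP: al; apply/mnmP => i; apply/esym; move: i.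
  by apply: (@base_digits_inj K) => // i; apply: ltK; eassumption.
(* The extra factor ['X] makes [x], and hence every coordinate of [v], nonzero. *)
have /closed_nonrootP[x] : 'X * \prod_j Q j != 0.
  by rewrite mulf_neq0 ?polyX_eq0 //; apply/prodf_neq0.
rewrite rootM rootX negb_or => /andP[x0 hx].
exists (fun i => x ^+ (K ^ i)); split=> [i|j]; first by rewrite expf_neq0.
apply: contra hx => /eqP hj.
rewrite /root horner_prod; apply/prodf_eq0; exists j => //.
apply/eqP; rewrite -[RHS]hj /Q horner_sum; apply: eq_bigr => a _.
rewrite hornerZ hornerXn; congr (_ * _).
rewrite /e -prodrXr; apply: eq_bigr => i _.
by rewrite -exprM mulnC.
Qed.

(** * Restriction of a polynomial to a line *)

Definition line_poly (R : comNzRingType) (n : nat) (f : mpoly n R)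
    (z v : 'I_n -> R) : {poly R} :=
  mmap polyC (fun i => (z i)%:P + v i *: 'X) f.

Lemma horner_line_poly (R : comNzRingType) (n : nat) (f : mpoly n R)
    (z v : 'I_n -> R) (t : R) :
  (line_poly f z v).[t] = meval (fun i => z i + t * v i) f.
Proof.
rewrite /line_poly /mmap mevalE horner_sum; apply: eq_bigr => a _.
rewrite hornerM hornerC /mmap1 horner_prod; congr (_ * _).
by apply: eq_bigr => i _; rewrite horner_exp !hornerE mulrC.
Qed.

(** The degree is only bounded by [d], and [c] may be 0; this makes the property multiplicative even
    when leading coefficients multiply to 0. *)
Definition size_coef_spec (R : nzRingType) (p : {poly R}) (d : nat) (c : R) :=
  (size p <= d.+1)%N /\ p`_d = c.

Lemma size_coef_specM (R : comNzRingType) (p q : {poly R}) (d e : nat) (a b : R) :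
  size_coef_spec p d a -> size_coef_spec q e b ->
  size_coef_spec (p * q) (d + e) (a * b).
Proof.
move=> [sp pd] [sq qe]; split.
  rewrite (leq_trans (size_polyMleq _ _)) //.
  by rewrite -ltnS -addnS -addSn; case: (_ + _)%N (leq_add sp sq).
have dlt : (d < (d + e).+1)%N by rewrite ltnS leq_addr.
rewrite coefM (bigD1 (Ordinal dlt)) //= addKn pd qe big1 ?addr0 // => i ne.
have [lt|] := ltnP d i; first by rewrite [p`_i]nth_default ?mul0r ?(leq_trans sp).
rewrite leq_eqVlt => /orP[/eqP E|lt]; first by case/eqP: ne; apply: val_inj.
by rewrite [q`_(_ - _)]nth_default ?mulr0 // (leq_trans sq) // ltn_subRL ltn_add2r.
Qed.

Lemma size_coef_specX (R : comNzRingType) (p : {poly R}) (a : R) (k : nat) :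
  size_coef_spec p 1 a -> size_coef_spec (p ^+ k) k (a ^+ k).
Proof.
move=> h; elim: k => [|k IH].
  by rewrite !expr0; split; rewrite ?size_poly1 ?coef1.
by rewrite !exprS -add1n; apply: size_coef_specM.
Qed.

(** A monomial of degree [k] restricts to a polynomial of degree at most [k] whose coefficient of
    index [k] is the monomial at [v]. Hence only the monomials of top degree reach the top
    coefficient. *)
Lemma line_poly_spec (R : comNzRingType) (n : nat) (f : mpoly n R)
    (z v : 'I_n -> R) :
  size_coef_spec (line_poly f z v) (msize f).-1 (topform f v).
Proof.
pose l i := (z i)%:P + v i *: 'X : {poly R}.
have sl i : size_coef_spec (l i) 1 (v i).
  split; last by rewrite coefD coefC coefZ coefX add0r mulr1.
  rewrite (leq_trans (size_polyD _ _)) // geq_max.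
  rewrite (leq_trans (size_polyC_leq1 _)) //=.
  by rewrite (leq_trans (size_scale_leq _ _)) ?size_polyX.
have sm a : size_coef_spec (mmap1 l a) (mdeg a) (\prod_i v i ^+ a i).
  rewrite mdegE /mmap1; apply: (big_ind3 (@size_coef_spec R)).
  - by split; rewrite ?size_poly1 ?coef1.
  - by move=> *; apply: size_coef_specM.
  - by move=> i _; apply: size_coef_specX.
have sd a : a \in msupp f -> (mdeg a <= (msize f).-1)%N.
  by move=> /msize_mdeg_lt; case: (msize f).
split.
  rewrite (leq_trans (size_sum _ _ _)) //; apply/bigmax_leqP_seq => a ha _.
  rewrite mul_polyC (leq_trans (size_scale_leq _ _)) //.
  by rewrite (leq_trans (sm a).1) // ltnS sd.
rewrite coef_sum /topform [RHS]big_mkcond !big_seq; apply: eq_bigr => a ha /=.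
rewrite mul_polyC coefZ; case: eqP => [<-|ne]; first by rewrite (sm a).2.
rewrite nth_default ?mulr0 // (leq_trans (sm a).1) //.
by rewrite ltn_neqAle sd // andbT; apply/eqP.
Qed.

(** Degree and leading coefficient of the restriction do not depend on [z], which makes the later
    estimates uniform in [z]. *)
Lemma line_poly_lead (R : comNzRingType) (n : nat) (f : mpoly n R)
    (z v : 'I_n -> R) : topform f v != 0 ->
  (size (line_poly f z v)).-1 = (msize f).-1 /\
  lead_coef (line_poly f z v) = topform f v.
Proof.
have [s c] := line_poly_spec f z v => h.
suff E : (size (line_poly f z v)).-1 = (msize f).-1 by rewrite lead_coefE E.
apply/eqP; rewrite eqn_leq; apply/andP; split; first by rewrite -subn1 leq_subLR.
rewrite leqNgt; apply: contra h => h.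
by rewrite -c nth_default // -ltnS; case: (size _) h.
Qed.

(** * Norms and polynomial growth *)

Lemma norm_meval_le (C : numFieldType) (n : nat) (f : mpoly n C)
    (z : 'I_n -> C) (N : C) : 1 <= N -> (forall i, `|z i| <= N) ->
  `|meval z f| <= (\sum_(a <- msupp f) `|mcoeff a f|) * N ^+ (msize f).-1.
Proof.
move=> N1 zN; rewrite mevalE mulr_suml (le_trans (ler_norm_sum _ _ _)) //.
rewrite !big_seq; apply: ler_sum => a ha.
rewrite normrM ler_wpM2l // normr_prod (@le_trans _ _ (N ^+ mdeg a)) //.
  rewrite mdegE -prodrXr; apply: ler_prod => i _.
  by rewrite normr_ge0 normrX lerXn2r // nnegrE ?(le_trans ler01).
by apply: ler_weXn2l => //; move: (msize_mdeg_lt ha); case: (msize f).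
Qed.

Local Notation normc := Normc.normc.

Lemma ler_normc (R : realType) (x y : R[i]) (c : R) :
  (`|x| <= c%:C%C * `|y|) = (normc x <= c * normc y).
Proof. by rewrite !normc_def -rmorphM lecR; case: x => ? ?; case: y => ? ?. Qed.

Lemma norm_normc (R : realType) (x : R[i]) : `|x| = (normc x)%:C%C.
Proof. by case: x => a b; rewrite normc_def. Qed.

Lemma normc_ge0 (R : realType) (x : R[i]) : 0 <= normc x.
Proof. by rewrite -lecR -norm_normc normr_ge0. Qed.

Lemma normc_gt0 (R : realType) (x : R[i]) : x != 0 -> 0 < normc x.
Proof. by rewrite -ltcR -norm_normc normr_gt0. Qed.

Lemma normc_real (R : realType) (x : R) : 0 <= x -> normc x%:C%C = x.
Proof. by move=> x0; rewrite /Normc.normc /= expr0n addr0 sqrtr_sqr ger0_norm. Qed.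

Lemma polycyl_norm_ge (R : realType) (n : nat) (z : 'I_n -> R[i]) i :
  normc (z i) <= polycyl_norm z.
Proof. exact: le_bigmax. Qed.

Lemma polycyl_norm_le (R : realType) (n : nat) (z : 'I_n -> R[i]) (b : R) :
  0 <= b -> (forall i, normc (z i) <= b) -> polycyl_norm z <= b.
Proof. by move=> b0 h; apply: bigmax_le. Qed.

Lemma polycyl_norm_ge0 (R : realType) (n : nat) (z : 'I_n -> R[i]) :
  0 <= polycyl_norm z.
Proof. exact: bigmax_ge_id. Qed.

Lemma polycyl_norm_line (R : realType) (n : nat) (z v : 'I_n -> R[i]) (t : R[i]) :
  polycyl_norm (fun i => z i + t * v i) <=
    polycyl_norm z + normc t * polycyl_norm v.
Proof.
apply: polycyl_norm_le => [|i].
  by rewrite addr_ge0 ?mulr_ge0 ?polycyl_norm_ge0 ?normc_ge0.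
rewrite (le_trans (le_normcD _ _)) // Normc.normcM lerD ?polycyl_norm_ge //.
by rewrite ler_wpM2l ?polycyl_norm_ge ?normc_ge0.
Qed.

Lemma polymap_eval_growth (R : realType) (n m : nat) (F : polymap R n m) :
  exists2 C : R, 0 < C & forall z, 1 <= polycyl_norm z ->
    polycyl_norm (polymap_eval F z) <=
      C * polycyl_norm z ^+ (\max_j (msize (F j)).-1).
Proof.
pose c j := \sum_(a <- msupp (F j)) normc (mcoeff a (F j)).
have c0 j : 0 <= c j by apply: sumr_ge0 => a _; apply: normc_ge0.
have C0 : 0 <= \sum_j c j by apply: sumr_ge0.
(* The summand 1 keeps the constant positive even if all coefficients vanish. *)
exists (1 + \sum_j c j) => [|z z1]; first by rewrite ltr_pwDl.
set N := polycyl_norm z in z1 *.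
have N0 : 0 <= N := le_trans ler01 z1.
apply: polycyl_norm_le => [|j]; first by rewrite mulr_ge0 ?exprn_ge0 ?addr_ge0.
apply: (@le_trans _ _ (c j * N ^+ (msize (F j)).-1)).
  rewrite -lecR -norm_normc rmorphM rmorphXn rmorph_sum /=.
  under [X in _ <= X * _]eq_bigr do rewrite -norm_normc.
  apply: norm_meval_le => [|i]; first by rewrite -(rmorph1 (real_complex R)) lecR.
  by rewrite norm_normc lecR polycyl_norm_ge.
apply: ler_pM; rewrite ?exprn_ge0 //.
  by rewrite (bigD1 j) //= addrCA lerDl addr_ge0 ?sumr_ge0.
by apply: ler_weXn2l => //; apply: (leq_bigmax j).
Qed.

(** * The nearest zero on a line, and unboundedness of the zero set *)

Lemma exists_near_zero (R : realType) (n m : nat) (F : polymap R n m)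
    (v : 'I_n -> R[i]) (j0 : 'I_m) :
  (forall j, topform (F j) v != 0) -> (1 < msize (F j0))%N ->
  forall z, exists t : R[i], let w := fun i => z i + t * v i in
    [/\ prod_zero_set F w,
        forall j, normc (meval w (F j)) <=
          2 ^+ (msize (F j)).-1 * normc (meval z (F j)) &
        forall j, normc (topform (F j) v) * normc t ^+ (msize (F j)).-1 <=
          normc (meval z (F j))].
Proof.
move=> T0 deg0 z; pose p j := line_poly (F j) z v.
have lead j := line_poly_lead z (T0 j).
have p0 j : p j != 0 by rewrite -lead_coef_eq0 (lead j).2.
pose P := \prod_j p j.
have P0 : P != 0 by apply/prodf_neq0.
have rootP x : root P x = [exists j, root (p j) x].
  rewrite /root horner_prod; apply/prodf_eq0/existsP => [[j _ h]|[j h]];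
  by exists j.
have [rs defP] := closed_field_poly_normal P.
have memrs x : (x \in rs) = root P x.
  by rewrite [in RHS]defP rootZ ?lead_coef_eq0 // root_prod_XsubC.
(* The restriction of [F j0] has positive degree, so [P] has a root and [rs] is nonempty. *)
have [x0 /= rx0] : exists x, root (p j0) x.
  apply/closed_rootP; apply/eqP => s1; have := (lead j0).1.
  by rewrite -/(p j0) s1; case: (msize _) deg0 => [|[]].
have [|t] := @seq_norm_argmin R[i] rs.
  have : x0 \in rs by rewrite memrs rootP; apply/existsP; exists j0.
  by case: (rs).
(* Being a root of one factor, [t] puts [w] in the zero set; being minimal among the roots of all
   factors, it allows the root estimate for each of them. *)
rewrite memrs rootP => /existsP[j1 rt] tmin; exists t => /=; set w := fun i => _.
have near j : forall x, root (p j) x -> `|t| <= `|x|.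
  by move=> x hx; apply: tmin; rewrite memrs rootP; apply/existsP; exists j.
have ev0 j : (p j).[0] = meval z (F j).
  by rewrite horner_line_poly; apply: meval_eq => i; rewrite mul0r addr0.
have evt j : (p j).[t] = meval w (F j) by rewrite horner_line_poly.
split=> [|j|j].
- by apply/eqP/prodf_eq0; exists j1; rewrite // /polymap_eval -evt.
- have [h _] := norm_horner_near_root (near j).
  by rewrite -ler_normc rmorphXn rmorph_nat -evt -ev0 -(lead j).1.
- have [_ h] := norm_horner_near_root (near j).
  by rewrite -lecR rmorphM rmorphXn -!norm_normc -ev0 -(lead j).1 -(lead j).2.
Qed.

(** The linear form [v i0 * w i1 - v i1 * w i0] is constant on lines of direction [v] and bounded by
    [c] times the norm of [w]. Starting at a point [z] where it equals the large number [s], any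
    zero on the line through [z] has norm at least [s / c]. *)
Lemma prod_zero_set_unbounded (R : realType) (n m : nat) (F : polymap R n m)
    (v : 'I_n -> R[i]) (j0 : 'I_m) : (2 <= n)%N -> (forall i, v i != 0) ->
  (forall j, topform (F j) v != 0) -> (1 < msize (F j0))%N ->
  forall M : R, exists2 w, prod_zero_set F w & M < polycyl_norm w.
Proof.
move=> n2 v0 T0 deg0 M.
pose i0 := Ordinal (ltnW n2); pose i1 := Ordinal n2.
pose c := normc (v i0) + normc (v i1).
have c0 : 0 < c by rewrite addr_gt0 // normc_gt0.
pose s := c * (1 + `|M|).
have s0 : 0 <= s by apply: mulr_ge0; [apply: ltW|apply: addr_ge0].
pose z (i : 'I_n) : R[i] := if i == i1 then s%:C%C / v i0 else 0.
have [t [Sw _ _]] := exists_near_zero T0 deg0 z.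
set w := (fun i => _) in Sw; exists w; first exact: Sw.
have E : s%:C%C = v i0 * w i1 - v i1 * w i0.
  by rewrite /w /z eqxx /=; field; apply: v0.
have : s <= c * polycyl_norm w.
  rewrite -[s in leLHS]normc_real // E (le_trans (le_normcD _ _)) //.
  rewrite normcN !Normc.normcM mulrDl lerD // ler_wpM2l ?normc_ge0 //;
  exact: polycyl_norm_ge.
rewrite ler_pM2l //; apply: lt_le_trans.
by rewrite (le_lt_trans (ler_norm M)) // ltrDr.
Qed.

(** * Comparison of admissible exponents *)

Lemma powR_comparable (R : realType) (x y nu : R) :
  0 < y -> y / 2 <= x -> x <= 2 * y ->
  2 `^ (- `|nu|) * y `^ nu <= x `^ nu.
Proof.
move=> y0 h1 h2; have x0 : 0 < x by apply: lt_le_trans h1; rewrite divr_gt0.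
(* For [nu >= 0] the bound comes from [y <= 2 * x], for [nu < 0] from [x <= 2 * y]. *)
have [nu0|nu0] := leP 0 nu.
  rewrite ger0_norm // powRN mulrC ler_pdivrMr ?powR_gt0 //.
  rewrite -powRM ?(ltW x0) //.
  rewrite ge0_ler_powR ?nnegrE ?mulr_ge0 ?(ltW x0) ?(ltW y0) //.
  by rewrite -ler_pdivrMr.
rewrite ltr0_norm // opprK.
have [k k0 ->] : exists2 k, 0 <= k & nu = - k.
  by exists (- nu); rewrite ?opprK // oppr_ge0 ltW.
rewrite !powRN -invfM lef_pV2 ?posrE ?mulr_gt0 ?powR_gt0 //.
rewrite -powRM ?(ltW y0) //.
by rewrite ge0_ler_powR ?nnegrE ?mulr_ge0 ?(ltW x0) ?(ltW y0).
Qed.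

(** If [nu] exceeded the maximal degree [D], then [A |w|^nu <= |F(w)| <= C |w|^D] would bound
    [|w|^(nu - D)] by [C / A], which fails beyond the threshold [M0]. *)
Lemma loj_set_le_degree (R : realType) (n m : nat) (F : polymap R n m)
    (S : set ('I_n -> R[i])) nu :
  (forall M : R, exists2 w, S w & M < polycyl_norm w) ->
  loj_set F S nu -> nu <= (\max_j (msize (F j)).-1)%:R.
Proof.
move=> unb [A [B [A0 B0 h]]].
have [C C0 hC] := polymap_eval_growth F; set D := (\max_j _)%N in hC *.
rewrite leNgt; apply/negP => lt; pose e := nu - D%:R.
have e0 : 0 < e by rewrite subr_gt0.
pose M0 := (C / A) `^ e^-1.
have [w Sw lw] := unb (B + 1 + M0).
set N := polycyl_norm w in lw.
have M00 : 0 <= M0 by apply: powR_ge0.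
have [NB N1 NM] : [/\ B < N, 1 <= N & M0 < N] by split; lra.
have N0 : 0 < N := lt_le_trans ltr01 N1.
have := le_trans (h w Sw NB) (hC w N1); rewrite -/N.
have -> : nu = e + D%:R by rewrite subrK.
rewrite powRD ?(gt_eqF N0) ?implybT // powR_mulrn ?(ltW N0) //.
rewrite mulrA ler_pM2r ?exprn_gt0 //.
rewrite mulrC -ler_pdivlMr // leNgt => /negP; apply.
have -> : C / A = M0 `^ e.
  by rewrite -powRrM mulVf ?gt_eqF // powRr1 // divr_ge0 ?ltW.
by rewrite gt0_ltr_powR ?nnegrE ?(ltW N0).
Qed.

Lemma loj_set_prod_zero_sub (R : realType) (n m : nat) (F : polymap R n m) nu :
  (2 <= n)%N -> (forall j, F j != 0) -> prod_zero_set F !=set0 ->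
  loj_set F (prod_zero_set F) nu -> loj_set F setT nu.
Proof.
move=> n2 F0 [z1 /eqP/prodf_eq0[j0 _ /eqP zj0]] hnu.
(* A nonzero polynomial with a zero is not constant. *)
have deg0 : (1 < msize (F j0))%N.
  rewrite ltnNge leq_eqVlt negb_or ltnS leqn0 msize_poly_eq0 F0 andbT.
  apply/msize_poly1P => -[c c0 Fc].
  by move: zj0; rewrite /polymap_eval Fc mevalC; apply/eqP.
have [v [v0 T0]] := exists_topform_neq0 F0.
have nuD := loj_set_le_degree (prod_zero_set_unbounded n2 v0 T0 deg0) hnu.
have [A [B [A0 B0 h]]] := hnu.
set D := (\max_j _)%N in nuD.
(* When the nearest zero is far, a component of maximal degree alone provides the lower bound. *)
have [j1 Dj1] : {j1 | D = (msize (F j1)).-1}.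
  by apply: bigop.eq_bigmax; apply/card_gt0P; exists j0.
pose V := polycyl_norm v.
have V0 : 0 < V.
  exact: lt_le_trans (normc_gt0 (v0 (Ordinal n2))) (polycyl_norm_ge _ _).
(* [A1] serves the near case: [2 ^ (- |nu|)] pays for replacing [|w|] by [|z|], and [2 ^+ D] for
   replacing [F w] by [F z]. [A2] serves the far case, where [|t| > N / (2 V)]. *)
pose A1 := A * 2 `^ (- `|nu|) / 2 ^+ D.
pose A2 := normc (topform (F j1) v) / (2 * V) ^+ D.
have A10 : 0 < A1 by rewrite divr_gt0 ?mulr_gt0 ?powR_gt0 ?exprn_gt0.
have A20 : 0 < A2 by rewrite divr_gt0 ?normc_gt0 ?exprn_gt0 ?mulr_gt0.
(* This threshold ensures both [N >= 1], so that powers of [N] increase with the exponent, and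
   [N / 2 > B], so that the hypothesis on the zero set applies at [w]. *)
exists (Num.min A1 A2), (1 + 2 * B); split.
- by rewrite lt_min A10.
- by rewrite addr_gt0 ?mulr_gt0.
move=> z _; set N := polycyl_norm z => hN.
have N1 : 1 <= N by lra.
have N0 : 0 < N by lra.
have BN : B < N / 2 by lra.
have [t [Sw wle top_le]] := exists_near_zero T0 deg0 z.
set w := (fun i => _) in Sw wle.
have [near|far] := leP (normc t * V) (N / 2).
  have wN : polycyl_norm w <= 2 * N.
    by have := polycyl_norm_line z v t; rewrite -/N -/V -/w; lra.
  have Nw : N / 2 <= polycyl_norm w.
    (* Going back from [w] to [z] along [- t] gives the lower bound on the norm of [w]. *)
    have : N <= polycyl_norm w + normc (- t) * V.
      rewrite (_ : N = polycyl_norm (fun i => w i + - t * v i)).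
        exact: polycyl_norm_line.
      by congr polycyl_norm; apply/funext => i; rewrite /w mulNr addrK.
    by rewrite normcN; lra.
  have Fw : polycyl_norm (polymap_eval F w) <=
      2 ^+ D * polycyl_norm (polymap_eval F z).
    apply: polycyl_norm_le => [|j].
      by rewrite mulr_ge0 ?exprn_ge0 ?polycyl_norm_ge0.
    apply: le_trans (wle j) _; apply: ler_pM; rewrite ?exprn_ge0 ?normc_ge0 //.
      by apply: ler_weXn2l; rewrite ?ler1n //; apply: (leq_bigmax j).
    exact: (polycyl_norm_ge (polymap_eval F z)).
  have hw : A * polycyl_norm w `^ nu <= polycyl_norm (polymap_eval F w).
    exact: h Sw (lt_le_trans BN Nw).
  apply: (@le_trans _ _ (A1 * N `^ nu)).
    by rewrite ler_wpM2r ?powR_ge0 // ge_min lexx.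
  rewrite /A1 mulrAC ler_pdivrMr ?exprn_gt0 // [leRHS]mulrC.
  apply: le_trans Fw; apply: le_trans hw; rewrite -mulrA ler_pM2l //.
  exact: powR_comparable.
(* Far case: [nu <= D] and [N >= 1] let [N ^+ D] dominate the power with exponent [nu]. *)
apply: (@le_trans _ _ (A2 * N ^+ D)).
  apply: ler_pM; rewrite ?powR_ge0 ?ge_min ?lexx ?orbT //.
    by rewrite le_min !ltW.
  by rewrite -powR_mulrn ?(ltW N0) // ler_powR.
apply: le_trans (polycyl_norm_ge (polymap_eval F z) j1).
apply: le_trans (top_le j1); rewrite /A2 -Dj1 mulrAC -mulrA -expr_div_n.
rewrite ler_wpM2l ?normc_ge0 // lerXn2r // ?nnegrE ?normc_ge0 //.
  by rewrite divr_ge0 ?mulr_ge0 ?ltW.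
by rewrite ler_pdivrMr ?mulr_gt0 //; lra.
Qed.

Theorem theorem1 (R : realType) (n m : nat) (hn : (2 <= n)%N) (hm : (1 <= m)%N)
    (F : polymap R n m) (hS : prod_zero_set F !=set0) :
  loj_exponent F setT = loj_exponent F (prod_zero_set F).
Proof.
(* The sets of admissible exponents themselves coincide, not only their suprema. *)
rewrite /loj_exponent; congr (ereal_sup (EFin @` _)).
apply/seteqP; split=> nu.
  by move=> [A [B [A0 B0 h]]]; exists A, B; split => // z _; apply: h.
have [F0|] := pselect (forall j, F j != 0); first exact: loj_set_prod_zero_sub.
move=> /existsNP[j /negP/negPn/eqP Fj].
suff -> : prod_zero_set F = setT by [].
apply/seteqP; split=> // z _; apply/eqP/prodf_eq0; exists j => //.
by rewrite /polymap_eval Fj meval0.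
Qed.
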